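(* Consider a pp-wave spacetime, i.e. a connected open set $M\subseteq\mathbb R^4$ with coordinates $(x,r,x^3,x^4)$ and metric $$ds^2=-2h\,(dx)^2+2\,dx\,dr-\tfrac12 f\,[(dx^3)^2+(dx^4)^2],$$ where $h=h(x,x^3,x^4)$ and $f=f(x^3,x^4)$ are nowhere vanishing smooth functions with $(ff_{33}-f_3^2)+(ff_{44}-f_4^2)=0$ (this includes, for $f\equiv-2$ and $h=-\frac12H$, the metric $ds^2=H\,(dx)^2+2\,dx\,dr+(dx^3)^2+(dx^4)^2$ with $H=H(x,x^3,x^4)$). Then: (i) the energy-momentum tensor $T$ is parallel if and only if it is cyclic parallel; (ii) if $T$ is cyclic parallel then it is of Codazzi type, but the converse fails: there is a pp-wave spacetime, i.e. a connected open set $M\subseteq\mathbb R^4$ with coordinates $(x,r,x^3,x^4)$ and metric $ds^2=-2h\,(dx)^2+2\,dx\,dr-\tfrac12 f\,[(dx^3)^2+(dx^4)^2]$, where $h=h(x,x^3,x^4)$ and $f=f(x^3,x^4)$ are nowhere vanishing smooth functions with $(ff_{33}-f_3^2)+(ff_{44}-f_4^2)=0$, whose $T$ is of Codazzi type but not cyclic parallel; (iii) if $h$ is harmonic in $x^3$ and $x^4$, i.e. $h_{33}+h_{44}=0$, then the Ricci tensor is zero (the space is vacuum), and in this case $\nabla T=0$.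
   Context: Coordinates $(x,r,x^3,x^4)$ are numbered $1,2,3,4$; subscripts on $f,h$ denote partial derivatives. $T=\frac{c^4}{8\pi G}\left[S-\left(\frac{\kappa}{2}-\Lambda\right)g\right]$, with $S$ the Ricci tensor, $\kappa$ the scalar curvature, $c,G>0$ constants and $\Lambda$ a real constant (cosmological constant). A symmetric $(0,2)$-tensor $T$ is parallel if $\nabla T=0$; of Codazzi type if $(\nabla_XT)(Y,Z)=(\nabla_YT)(X,Z)$ for all vector fields; cyclic parallel if $(\nabla_XT)(Y,Z)+(\nabla_YT)(Z,X)+(\nabla_ZT)(X,Y)=0$ for all vector fields. *)

(* Defs.v *)
From HB Require Import structures.
From mathcomp Require Import all_boot all_order all_algebra.
From mathcomp Require Import all_classical all_reals all_analysis.

Set Implicit Arguments.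
Unset Strict Implicit.
Unset Printing Implicit Defensive.

Import Order.TTheory GRing.Theory Num.Theory.
Import numFieldNormedType.Exports.

Local Open Scope classical_set_scope.
Local Open Scope ring_scope.

(* The coordinates x, r, x^3, x^4, numbered 1, 2, 3, 4 in the mathematics, are
   the columns 0, 1, 2, 3 of a row vector. *)
Definition ix : 'I_4 := @Ordinal 4 0 isT.
Definition ir : 'I_4 := @Ordinal 4 1 isT.
Definition i3 : 'I_4 := @Ordinal 4 2 isT.
Definition i4 : 'I_4 := @Ordinal 4 3 isT.

Section Tensors.
Variable R : realType.

(* Fields are total functions on R^4; only their values on the open domain M
   under consideration matter, since all the notions below are local. *)
Notation point := 'rV[R]_4.
Notation scalar_field := (point -> R).
Notation vector_field := (point -> 'rV[R]_4).
(* A (0,2)-tensor field, given by its matrix of components. *)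
Notation tensor2 := (point -> 'M[R]_4).

Definition pd (i : 'I_4) (u : scalar_field) : scalar_field :=
  'D_(delta_mx 0 i : point) u.

Definition iter_pd (s : seq 'I_4) (u : scalar_field) : scalar_field :=
  foldr pd u s.

(* C^infinity on the open set M: every iterated partial derivative exists and
   is continuous at the points of M. *)
Definition smooth_on (M : set point) (u : scalar_field) : Prop :=
  forall (s : seq 'I_4) (p : point), M p ->
    {for p, continuous (iter_pd s u)} /\
    forall i : 'I_4, derivable (iter_pd s u) p (delta_mx 0 i).

Definition smooth_vf_on (M : set point) (X : vector_field) : Prop :=
  forall i : 'I_4, smooth_on M (fun p => X p 0 i).

Section Curvature.
Variable g : tensor2.

(* Gamma^k_ij *)
Definition christoffel (k i j : 'I_4) : scalar_field := fun p =>
  2^-1 * \sum_(l < 4) invmx (g p) k l *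
    (pd i (fun q => g q j l) p + pd j (fun q => g q i l) p
     - pd l (fun q => g q i j) p).

(* R^l_kij, with R(d_i, d_j) d_k = R^l_kij d_l and
   R(X, Y) = [nabla_X, nabla_Y] - nabla_[X, Y] *)
Definition riemann (l k i j : 'I_4) : scalar_field := fun p =>
  pd i (christoffel l j k) p - pd j (christoffel l i k) p
  + \sum_(m < 4) (christoffel l i m p * christoffel m j k p
                  - christoffel l j m p * christoffel m i k p).

(* S_kj = R^i_kij, so that round spheres have positive Ricci curvature *)
Definition ricci : tensor2 := fun p =>
  \matrix_(k, j) \sum_(i < 4) riemann i k i j p.

Definition scalar_curvature : scalar_field := fun p =>
  \sum_(i < 4) \sum_(j < 4) invmx (g p) i j * ricci p i j.

Definition energy_momentum (c G Lam : R) : tensor2 := fun p =>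
  (c ^+ 4 / (8 * pi * G)) *:
    (ricci p - (scalar_curvature p / 2 - Lam) *: g p).

(* (nabla_{d_i} T)(d_j, d_k) for the Levi-Civita connection of g *)
Definition nabla_comp (T : tensor2) (i j k : 'I_4) : scalar_field := fun p =>
  pd i (fun q => T q j k) p
  - \sum_(l < 4) christoffel l i j p * T p l k
  - \sum_(l < 4) christoffel l i k p * T p j l.

(* (nabla_X T)(Y, Z) *)
Definition nabla (T : tensor2) (X Y Z : vector_field) : scalar_field := fun p =>
  \sum_(i < 4) \sum_(j < 4) \sum_(k < 4)
    X p 0 i * Y p 0 j * Z p 0 k * nabla_comp T i j k p.

Variable M : set point.

Definition parallel (T : tensor2) : Prop :=
  forall X Y Z : vector_field,
    smooth_vf_on M X -> smooth_vf_on M Y -> smooth_vf_on M Z ->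
    forall p, M p -> nabla T X Y Z p = 0.

Definition codazzi (T : tensor2) : Prop :=
  forall X Y Z : vector_field,
    smooth_vf_on M X -> smooth_vf_on M Y -> smooth_vf_on M Z ->
    forall p, M p -> nabla T X Y Z p = nabla T Y X Z p.

Definition cyclic_parallel (T : tensor2) : Prop :=
  forall X Y Z : vector_field,
    smooth_vf_on M X -> smooth_vf_on M Y -> smooth_vf_on M Z ->
    forall p, M p ->
      nabla T X Y Z p + nabla T Y Z X p + nabla T Z X Y p = 0.

End Curvature.

(* -2 h dx^2 + 2 dx dr - (1/2) f [(dx^3)^2 + (dx^4)^2]; the term 2 dx dr is
   dx (x) dr + dr (x) dx *)
Definition pp_metric (h f : scalar_field) : tensor2 := fun p =>
  (- 2 * h p) *: delta_mx ix ix
  + (delta_mx ix ir + delta_mx ir ix)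
  + (- 2^-1 * f p) *: (delta_mx i3 i3 + delta_mx i4 i4).

(* u is a function of the coordinates in I alone *)
Definition depends_only_on (M : set point) (I : {set 'I_4})
    (u : scalar_field) : Prop :=
  forall p q : point, M p -> M q ->
    (forall i, i \in I -> p 0 i = q 0 i) -> u p = u q.

Record pp_wave (M : set point) (h f : scalar_field) : Prop := PPWave {
  pp_open : open M;
  pp_connected : connected M;
  pp_h_smooth : smooth_on M h;
  pp_f_smooth : smooth_on M f;
  pp_h_coord : depends_only_on M [set ix; i3; i4]%SET h;
  pp_f_coord : depends_only_on M [set i3; i4]%SET f;
  pp_h_neq0 : forall p, M p -> h p != 0;
  pp_f_neq0 : forall p, M p -> f p != 0;
  pp_f_eq : forall p, M p ->
    (f p * pd i3 (pd i3 f) p - pd i3 f p ^+ 2)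
    + (f p * pd i4 (pd i4 f) p - pd i4 f p ^+ 2) = 0
}.

Lemma pd_cst (i : 'I_4) (a : R) : pd i (fun=> a) = (fun=> 0).
Proof. by apply/funext => p; exact: derive_cst. Qed.

Lemma smooth_on_cst (M : set point) (a : R) : smooth_on M (fun=> a).
Proof.
move=> s p _.
have [b ->] : exists b, iter_pd s (fun=> a) = (fun=> b).
  elim: s => [|i s [b IHs]]; first by exists a.
  by exists 0; rewrite /= IHs pd_cst.
by split=> [|i]; [exact: cst_continuous | exact: derivable_cst].
Qed.

Lemma smooth_on_scale (M : set point) (a : R) (u : scalar_field) :
  open M -> smooth_on M u -> smooth_on M (fun p => a * u p).
Proof.
move=> oM su.
have nearM p (v w : scalar_field) : M p -> (forall q, M q -> v q = w q) ->
    \near p, v p = w p.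
  by move=> Mp vw; near=> q; apply: vw; near: q; exact: open_nbhs_nbhs.
have e s q : M q -> iter_pd s (fun p => a * u p) q = a * iter_pd s u q.
  elim: s q => [//|i s IHs] q Mq /=.
  rewrite /pd (near_eq_derive _ (nearM _ _ _ Mq IHs)).
  exact: (@deriveZ _ _ _ (iter_pd s u) a q _ ((su s q Mq).2 i)).
move=> s p Mp; have [cu du] := su s p Mp.
have en := nearM _ _ _ Mp (fun q Mq => esym (e s q Mq)).
split=> [|i]; last first.
  exact: near_eq_derivable en (@derivableZ _ _ _ (iter_pd s u) a p _ (du i)).
rewrite /prop_for /continuous_at (e s p Mp).
exact: cvg_trans (near_eq_cvg en) (cvgM (cvg_cst a) cu).
Unshelve. all: by end_near. Qed.

(* The metrics H dx^2 + 2 dx dr + (dx^3)^2 + (dx^4)^2 are the case f = -2,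
   h = - H / 2. *)
Lemma pp_metric_brinkmann (H : scalar_field) (p : point) :
  pp_metric (fun q => - 2^-1 * H q) (fun=> - 2) p =
  H p *: delta_mx ix ix + (delta_mx ix ir + delta_mx ir ix)
  + (delta_mx i3 i3 + delta_mx i4 i4).
Proof.
have two_neq0 : (2 : R) != 0 by rewrite pnatr_eq0.
by rewrite /pp_metric mulrA !mulrNN mulfV // mul1r mulVf // scale1r.
Qed.

Lemma pp_wave_brinkmann (M : set point) (H : scalar_field) :
  open M -> connected M -> smooth_on M H ->
  depends_only_on M [set ix; i3; i4]%SET H -> (forall p, M p -> H p != 0) ->
  pp_wave M (fun q => - 2^-1 * H q) (fun=> - 2).
Proof.
move=> oM cM sH dH H0; split=> //.
- exact: smooth_on_scale.
- exact: smooth_on_cst.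
- by move=> p q Mp Mq pq; rewrite (dH p q).
- by move=> p Mp; rewrite mulf_neq0 ?H0.
- by move=> p Mp; rewrite !pd_cst !mulr0 expr0n subrr addr0.
Qed.

End Tensors.

(* Main.v *)
Require Import Defs.
From mathcomp Require Import all_boot all_order all_algebra.
From mathcomp Require Import all_classical all_reals all_analysis.
From mathcomp Require Import ring.
Import Order.TTheory GRing.Theory Num.Theory.
Import numFieldNormedType.Exports.
Set Implicit Arguments.
Unset Strict Implicit.
Unset Printing Implicit Defensive.
Local Open Scope classical_set_scope.
Local Open Scope ring_scope.

(** For a pp-wave the whole Ricci tensor collapses to one component,
      S = phi dx^2   with   phi = - 2 (h_33 + h_44) / f.
    The Christoffel symbols are -h_x, -h_3, -h_4, the quotients -2 h_3 / f,
    -2 h_4 / f and s = f_3 / (2 f), t = f_4 / (2 f).  Besides S_xx, the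
    contraction leaves only -(s_3 + t_4) in S_33 and S_44, and the difference
    of s_4 and t_3 in S_34.  The first vanishes because the condition on f says
    that log |f| is harmonic (the transverse surface is flat), the second
    because second derivatives commute ([derive_schwarz]).  See
    [pp_symbols_ricci] and [ricci_pp_metric].

    Since g^xx = 0, the scalar curvature vanishes, so T = K (S + Lam g) with
    K > 0.  The metric is parallel, and dx is parallel because the
    Christoffel symbols with upper index x vanish.  Hence
      (nabla_i T)_jk = K d_i phi   if j = k = x,   and 0 otherwise
    ([nabla_comp_energy_momentum]), and all three conditions on T can be read
    off from d phi.  T is parallel exactly when d phi = 0; it is Codazzi
    exactly when d phi is a multiple of dx; and the components (i, x, x) of the
    cyclic condition say d_i phi = 0 for i <> x and 3 d_x phi = 0, so that
    cyclic parallel is again d phi = 0.  This yields (i) and the implication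
    in (ii).  If h is harmonic in x^3 and x^4 then phi = 0, which is (iii).

    For the strictness in (ii), it is enough that phi depends on x and on nothing
    else.  On all of R^4, take f = -2 and
    h = - (1 + x^2) (1 + (x^3)^2) / 2: it has no zero, and phi = - (1 + x^2). *)

(** * Directional derivatives *)

Section EqualIncrements.
Variables (R : realType) (V V' W : normedModType R).
Variables (u : V -> W) (u' : V' -> W) (p v : V) (p' v' : V').
Hypothesis increments :
  \forall t \near (0 : R), u (t *: v + p) - u p = u' (t *: v' + p') - u' p'.

(** A directional derivative sees a function only through its increments along
    a line.  This one remark transports derivatives between functions on
    different spaces: restriction to a line, translation, composition with a
    coordinate. *)
Lemma derivable_eq_increments : derivable u p v -> derivable u' p' v'.
Proof.
move=> /cvg_ex[/= l ul]; apply/cvg_ex; exists l => /=.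
apply: cvg_trans ul; apply/near_eq_cvg/cvg_within.
by near=> t; rewrite /= (near increments t).
Unshelve. all: by end_near. Qed.

Lemma derive_eq_increments : 'D_v u p = 'D_v' u' p'.
Proof.
rewrite /derive; congr (lim _).
rewrite eqEsubset; split; apply/near_eq_cvg/cvg_within;
  by near=> t; rewrite /= (near increments t).
Unshelve. all: by end_near. Qed.

End EqualIncrements.

Section Schwarz.
Variables (R : realType) (V : normedModType R).
Implicit Types (u : V -> R) (v w p : V).

Lemma is_derive_line u v p (s : R) : derivable u (p + s *: v) v ->
  is_derive s 1 (fun t => u (p + t *: v)) ('D_v u (p + s *: v)).
Proof.
move=> du; pose l t := u (p + t *: v).
have inc : \forall t \near (0 : R),
    u (t *: v + (p + s *: v)) - u (p + s *: v) =
    l (t *: 1 + s) - l s.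
  by near=> t; rewrite /l [t *: 1]mulr1 scalerDl addrCA.
split; first exact: (derivable_eq_increments inc).
by rewrite -(derive_eq_increments inc).
Unshelve. all: by end_near. Qed.

Lemma line_increment u v p (t : R) : 0 < t ->
  (forall s : R, 0 <= s <= t -> derivable u (p + s *: v) v) ->
  exists2 s : R, 0 <= s <= t & u (p + t *: v) - u p = 'D_v u (p + s *: v) * t.
Proof.
move=> t0 du.
have dl (s : R) : s \in `[0, t]%R ->
    is_derive s 1 (fun t => u (p + t *: v)) ('D_v u (p + s *: v)).
  by rewrite in_itv /= => st; exact/is_derive_line/du.
have cl : {within `[0, t], continuous (fun s => u (p + s *: v))}.
  apply: derivable_within_continuous => s /dl ds; by case: ds.
have dl' (s : R) : s \in `]0, t[%R ->
    is_derive s 1 (fun t => u (p + t *: v)) ('D_v u (p + s *: v)).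
  by move=> s0t; apply: dl; exact: subset_itv_oo_cc.
have [s] := MVT_segment (ltW t0) dl' cl.
by rewrite in_itv /= scale0r addr0 subr0 => st e; exists s.
Qed.

(** Apply the mean value theorem along [v] to [q |-> u (q + t w) - u q], then
    along [w] to ['D_v u].  The left-hand side is symmetric in [v] and [w], up
    to the order of the terms. *)
Lemma second_difference u v w p (t : R) : 0 < t ->
  (forall r s : R, 0 <= r <= t -> 0 <= s <= t ->
     derivable u (p + r *: v + s *: w) v /\
     derivable ('D_v u) (p + r *: v + s *: w) w) ->
  exists r s : R, [/\ 0 <= r <= t, 0 <= s <= t &
    u (p + t *: v + t *: w) - u (p + t *: v) - (u (p + t *: w) - u p) =
    'D_w ('D_v u) (p + r *: v + s *: w) * t ^+ 2].
Proof.
move=> t0 du; have t00 : (0 : R) <= (0 : R) <= t by rewrite lexx (ltW t0).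
have tt : 0 <= t <= t by rewrite (ltW t0) lexx.
pose ut q := u (q + t *: w); pose d q := ut q - u q.
have dd (r : R) : 0 <= r <= t -> is_derive (p + r *: v) v d
    ('D_v u (p + r *: v + t *: w) - 'D_v u (p + r *: v)).
  move=> rt; have du1 := (du r t rt tt).1.
  have du0 := (du r 0 rt t00).1; rewrite scale0r addr0 in du0.
  have inc : \forall h \near (0 : R),
      u (h *: v + (p + r *: v + t *: w)) - u (p + r *: v + t *: w) =
      ut (h *: v + (p + r *: v)) - ut (p + r *: v).
    by near=> h; rewrite /ut !addrA.
  rewrite (derive_eq_increments inc).
  have dut : derivable ut (p + r *: v) v := derivable_eq_increments inc du1.
  exact: (is_deriveB (derivableP dut) (derivableP du0)).
have [r rt er] := @line_increment d v p t t0 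
  (fun r rt => let: DeriveDef dr _ := dd r rt in dr).
have [s st es] := @line_increment ('D_v u) w (p + r *: v) t t0
  (fun s st => (du r s rt st).2).
exists r, s; split => //.
have := dd r rt => /@derive_val e; move: er; rewrite e es /d /ut => ->.
by rewrite expr2 mulrA.
Unshelve. all: by end_near. Qed.

(** Both mixed derivatives, taken at suitable points of a parallelogram at [p],
    are the second difference of [u] divided by its scale squared.  So they
    take a common value arbitrarily close to [p], and continuity concludes. *)
Lemma derive_schwarz u v w p :
  (\forall q \near p, [/\ derivable u q v, derivable u q w,
     derivable ('D_v u) q w & derivable ('D_w u) q v]) ->
  {for p, continuous ('D_w ('D_v u))} -> {for p, continuous ('D_v ('D_w u))} ->
  'D_w ('D_v u) p = 'D_v ('D_w u) p.
Proof.
move=> du c1 c2; apply/eqP; rewrite -subr_eq0 -normr_le0.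
apply/ler_addgt0Pl => e e0.
rewrite addr0; have e20 : 0 < e / 2 by rewrite divr_gt0.
have /nbhs_ballP[d /= d0 dP] : \forall q \near p, [/\ derivable u q v,
    derivable u q w, derivable ('D_v u) q w & derivable ('D_w u) q v] /\
    `|'D_w ('D_v u) p - 'D_w ('D_v u) q| <= e / 2 /\
    `|'D_v ('D_w u) p - 'D_v ('D_w u) q| <= e / 2.
  apply: filterI; first exact: du.
  by apply: filterI; [move/cvgr_dist_le: c1 | move/cvgr_dist_le: c2]; apply.
(* Small enough for the parallelogram spanned by [t v] and [t w] to stay in the
   ball. *)
pose t := d / 2 / (1 + `|v| + `|w|).
have n0 : 0 < 1 + `|v| + `|w| by rewrite ltr_pwDl // addr_gt0 // ltr_pwDl.
have t0 : 0 < t by rewrite !divr_gt0.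
have box (r s : R) : 0 <= r <= t -> 0 <= s <= t ->
    ball p d (p + r *: v + s *: w).
  move=> /andP[r0 rt] /andP[s0 st]; rewrite -ball_normE /= -addrA opprD addNKr.
  rewrite normrN (le_lt_trans (ler_normD _ _)) // !normrZ !ger0_norm //.
  apply: (@le_lt_trans _ _ (t * (1 + `|v| + `|w|))).
    rewrite 2!mulrDr -addrA; apply: ler_wpDl; first by rewrite mulr1 ltW.
    by apply: lerD; exact: ler_wpM2r.
  by rewrite divfK ?gt_eqF // gtr_pMr // invf_lt1 // ltr1n.
have [r [s [rt st e1]]] := @second_difference u v w p t t0 (fun r s rt st =>
  let: And4 a _ b _ := (dP _ (box r s rt st)).1 in conj a b).
have box' (s' r' : R) : 0 <= s' <= t -> 0 <= r' <= t ->
    ball p d (p + s' *: w + r' *: v).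
  by move=> ? ?; rewrite addrAC; exact: box.
have [s' [r' [st' rt' e2]]] := @second_difference u w v p t t0 (fun s r st rt =>
  let: And4 _ a _ b := (dP _ (box' s r st rt)).1 in conj a b).
have ac (x y z a : R) : x - y - (z - a) = x - z - (y - a) by ring.
have e12 : 'D_w ('D_v u) (p + r *: v + s *: w) =
    'D_v ('D_w u) (p + s' *: w + r' *: v).
  apply: (mulIf (_ : t ^+ 2 != 0)); first by rewrite expf_neq0 ?gt_eqF.
  apply: etrans (esym e1) (etrans _ e2).
  by rewrite ac (addrAC p (t *: w)).
have [_ [a1 _]] := dP _ (box _ _ rt st).
have [_ [_ a2]] := dP _ (box' _ _ st' rt').
rewrite -e12 in a2; rewrite [leRHS]splitr.
apply: (le_trans (ler_distD ('D_w ('D_v u) (p + r *: v + s *: w)) _ _)).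
rewrite distrC in a2; exact: lerD a1 a2.
Qed.

End Schwarz.

(** * Partial derivatives of fields on an open set *)

Section Fields.
Variables (R : realType) (M : set 'rV[R]_4).
Hypothesis oM : open M.
Implicit Types (u w : 'rV[R]_4 -> R) (p : 'rV[R]_4) (i j : 'I_4).

Lemma near_domain p : M p -> \near p, M p.
Proof. by move=> Mp; exact: open_nbhs_nbhs. Qed.

Lemma near_domain_line p i : M p ->
  \forall t \near (0 : R), M (t *: delta_mx 0 i + p).
Proof.
move=> Mp; have c : (fun t : R => t *: delta_mx 0 i + p) @ 0 --> p.
  rewrite -[X in _ --> X]add0r -[X in _ --> X + p](scale0r (delta_mx 0 i)).
  by apply: cvgD; [exact: scalel_continuous | exact: cvg_cst].
exact: c (near_domain Mp).
Qed.

Lemma pd_eq_on u w : (forall q, M q -> u q = w q) ->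
  forall p i, M p -> pd i u p = pd i w p.
Proof.
move=> uw p i Mp; apply: near_eq_derive.
by near=> q; apply: uw; near: q; exact: near_domain.
Unshelve. all: by end_near. Qed.

Lemma smooth_on_pd u i : smooth_on M u -> smooth_on M (pd i u).
Proof.
by move=> su s; have := su (rcons s i); rewrite /iter_pd foldr_rcons.
Qed.

Lemma smooth_on_derivable u i p : smooth_on M u -> M p ->
  derivable u p (delta_mx 0 i).
Proof. by move=> su /(su [::])[_]; apply. Qed.

Lemma smooth_on_continuous u p : smooth_on M u -> M p ->
  {for p, continuous u}.
Proof. by move=> su /(su [::])[]. Qed.

Lemma pdC u i j p : smooth_on M u -> M p -> pd j (pd i u) p = pd i (pd j u) p.
Proof.
move=> su Mp; apply: derive_schwarz.
- near=> q; have Mq : M q by near: q; exact: near_domain.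
  split; first exact: smooth_on_derivable su Mq.
  - exact: smooth_on_derivable su Mq.
  - exact: smooth_on_derivable (smooth_on_pd i su) Mq.
  - exact: smooth_on_derivable (smooth_on_pd j su) Mq.
- exact: smooth_on_continuous (smooth_on_pd _ (smooth_on_pd _ su)) Mp.
- exact: smooth_on_continuous (smooth_on_pd _ (smooth_on_pd _ su)) Mp.
Unshelve. all: by end_near. Qed.

(** Two points with the same coordinates in [I] keep this property when both are
    moved along [e_i], so the increments of [u] there agree. *)
Lemma depends_only_on_pd (I : {set 'I_4}) u i :
  depends_only_on M I u -> depends_only_on M I (pd i u).
Proof.
move=> du p q Mp Mq pq; apply: derive_eq_increments.
near=> t; rewrite (du p q) //; congr (_ - _); apply: du.
- by near: t; exact: near_domain_line.
- by near: t; exact: near_domain_line.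
- by move=> k kI; rewrite !mxE pq.
Unshelve. all: by end_near. Qed.

Lemma pd_depends_only_on0 (I : {set 'I_4}) u i p : depends_only_on M I u ->
  i \notin I -> M p -> pd i u p = 0.
Proof.
move=> du iI Mp; rewrite -(derive_cst (0 : R) p (delta_mx 0 i)).
apply: derive_eq_increments; near=> t.
rewrite (du (t *: delta_mx 0 i + p) p) // ?subrr //.
- by near: t; exact: near_domain_line.
- move=> k kI; rewrite !mxE eqxx /=; case: eqP => [e|_].
    by rewrite -e kI in iI.
  by rewrite mulr0 add0r.
Unshelve. all: by end_near. Qed.

Lemma is_derive_quotient u w (a : R) p i :
  derivable u p (delta_mx 0 i) -> derivable w p (delta_mx 0 i) -> w p != 0 ->
  is_derive p (delta_mx 0 i) (fun q => a * u q / w q)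
    (a * (pd i u p * w p - u p * pd i w p) / w p ^+ 2).
Proof.
move=> du dw w0.
have dV := DeriveDef (derivableV w0 dw) (deriveV w0 dw).
have := is_deriveM (is_deriveZ a (derivableP du)) dV.
rewrite -/(pd i u p) -/(pd i w p).
move: (pd i u p) (pd i w p) => x y d; apply: is_derive_eq d _.
change (a * u p * (- w p ^- 2 * y) + (w p)^-1 * (a * x) =
  a * (x * w p - u p * y) / w p ^+ 2).
by field.
Qed.

End Fields.

Lemma ord4_ind (P : 'I_4 -> Prop) :
  P ix -> P ir -> P i3 -> P i4 -> forall i, P i.
Proof.
move=> Px Pr P3 P4 i.
have : i \in [:: ix; ir; i3; i4].
  by rewrite !inE -!val_eqE; case: i => [[|[|[|[|]]]]].
by rewrite !inE => /or4P[] /eqP->.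
Qed.

Lemma big_ord4 (V : nmodType) (F : 'I_4 -> V) :
  \sum_(i < 4) F i = F ix + F ir + F i3 + F i4.
Proof.
by rewrite !big_ord_recr big_ord0 /= add0r; congr (_ + _ + _ + _);
  congr F; exact: val_inj.
Qed.

(** * The Levi-Civita connection of a general metric *)

Section LeviCivita.
Variable R : realType.
Implicit Types (g A B : 'rV[R]_4 -> 'M[R]_4) (p : 'rV[R]_4) (i j k l : 'I_4).

Lemma christoffel_lower g i j k p : g p \in unitmx ->
  \sum_(l < 4) g p k l * christoffel g l i j p =
  2^-1 * (pd i (fun q => g q j k) p + pd j (fun q => g q i k) p
          - pd k (fun q => g q i j) p).
Proof.
move=> gu; pose X l := pd i (fun q => g q j l) p + pd j (fun q => g q i l) p
          - pd l (fun q => g q i j) p.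
have -> : \sum_(l < 4) g p k l * christoffel g l i j p =
    2^-1 * (g p *m (invmx (g p) *m \col_l X l)) k 0.
  rewrite mxE mulr_sumr; apply: eq_bigr => l _.
  rewrite /christoffel mulrCA; congr (_ * (_ * _)).
  by rewrite mxE; apply: eq_bigr => m _; rewrite mxE.
by rewrite mulKVmx // mxE.
Qed.

(** Lowering the upper index turns the two Christoffel terms into halves of
    derivatives of [g], which add up to [d_i g_jk] by symmetry of [g]. *)
Lemma nabla_comp_metric g i j k p : (forall q, (g q)^T = g q) ->
  g p \in unitmx -> nabla_comp g g i j k p = 0.
Proof.
move=> gT gu; have gC q a b : g q a b = g q b a by rewrite -{1}gT mxE.
have lower a b d : \sum_(l < 4) christoffel g l a b p * g p l d =
    \sum_(l < 4) g p d l * christoffel g l a b p.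
  by apply: eq_bigr => l _; rewrite mulrC gC.
rewrite /nabla_comp lower christoffel_lower //.
have -> : \sum_(l < 4) christoffel g l i k p * g p j l =
    \sum_(l < 4) g p j l * christoffel g l i k p.
  by apply: eq_bigr => l _; rewrite mulrC.
rewrite christoffel_lower //.
have -> : (fun q => g q k j) = (fun q => g q j k).
  by apply/funext => q; rewrite gC.
move: (pd _ _ _) (pd _ _ _) (pd _ _ _) => x y z.
by field.
Qed.

Lemma nabla_comp_lin g A B (a b : R) i j k p :
  derivable (fun q => A q j k) p (delta_mx 0 i) ->
  derivable (fun q => B q j k) p (delta_mx 0 i) ->
  nabla_comp g (fun q => a *: (A q + b *: B q)) i j k p =
  a * (nabla_comp g A i j k p + b * nabla_comp g B i j k p).
Proof.
move=> dA dB; rewrite /nabla_comp.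
have -> : pd i (fun q => (a *: (A q + b *: B q)) j k) p =
    a * (pd i (fun q => A q j k) p + b * pd i (fun q => B q j k) p).
  have -> : (fun q => (a *: (A q + b *: B q)) j k) =
      a \*: ((fun q => A q j k) + b \*: (fun q => B q j k)).
    by apply/funext => q; rewrite !mxE.
  exact: (@derive_val _ _ _ _ _ _ _ (is_deriveZ a
    (is_deriveD (derivableP dA) (is_deriveZ b (derivableP dB))))).
rewrite !big_ord4 !mxE.
move: (pd _ _ _) (pd _ _ _) => x y.
move: (christoffel g) => Gam.
ring.
Qed.

Lemma nabla_comp_eq_on (M : set 'rV[R]_4) g A B : open M ->
  (forall q, M q -> A q = B q) ->
  forall p i j k, M p -> nabla_comp g A i j k p = nabla_comp g B i j k p.
Proof.
move=> oM AB p i j k Mp; rewrite /nabla_comp (AB p Mp).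
have -> // : pd i (fun q => A q j k) p = pd i (fun q => B q j k) p.
by apply: (pd_eq_on oM) Mp => q Mq; rewrite AB.
Qed.

End LeviCivita.

(** * The algebra of the Christoffel symbols of a pp-wave *)

Section Arrays.
Variable R : realType.
Implicit Types (i j k l m : 'I_4).

(** The zero pattern shared by the metric, its inverse (the entry [c] at (r, r)
    is zero for the metric) and the coordinate derivatives of the metric. *)
Definition pp_array (a b c d : R) i j : R :=
  match nat_of_ord i, nat_of_ord j with
  | 0, 0 => a
  | 0, 1 | 1, 0 => b
  | 1, 1 => c
  | 2, 2 | 3, 3 => d
  | _, _ => 0
  end.

(** The zero pattern of [Gamma^k_ij].  The entries [s] and [t] are those of the
    conformally flat transverse metric.  The pattern is linear in the seven
    entries, so the derivatives of the symbols have the same form. *)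
Definition pp_symbols (a b c u v s t : R) k i j : R :=
  match nat_of_ord k, nat_of_ord i, nat_of_ord j with
  | 1, 0, 0 => a
  | 1, 0, 2 | 1, 2, 0 => b
  | 1, 0, 3 | 1, 3, 0 => c
  | 2, 0, 0 => u
  | 3, 0, 0 => v
  | 2, 2, 2 | 3, 2, 3 | 3, 3, 2 => s
  | 3, 3, 3 | 2, 2, 3 | 2, 3, 2 => t
  | 2, 3, 3 => - s
  | 3, 2, 2 => - t
  | _, _, _ => 0
  end.

Lemma pd_pp_symbols (a b c u v s t : 'rV[R]_4 -> R) k i j m p :
  derivable s p (delta_mx 0 m) -> derivable t p (delta_mx 0 m) ->
  pd m (fun q => pp_symbols (a q) (b q) (c q) (u q) (v q) (s q) (t q) k i j) p =
  pp_symbols (pd m a p) (pd m b p) (pd m c p) (pd m u p) (pd m v p)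
    (pd m s p) (pd m t p) k i j.
Proof.
move=> ds dt; rewrite /pp_symbols.
case: (nat_of_ord k) => [|[|[|[|?]]]]; case: (nat_of_ord i) => [|[|[|[|?]]]];
  case: (nat_of_ord j) => [|[|[|[|?]]]];
  lazymatch goal with
  | |- _ = 0 => exact: derive_cst
  | |- _ = - _ => exact: deriveN
  | _ => reflexivity
  end.
Qed.

(** The contraction that defines the Ricci tensor, for arbitrary values of the
    symbols and of their derivatives [dG m] in the direction [m].  The last two
    hypotheses are the flatness of the transverse metric and the equality of
    mixed derivatives of [log |f|]; the others say that nothing depends on r,
    and that f does not depend on x.  Together they leave only S_xx. *)
Lemma pp_symbols_ricci (a b c u v s t : R) (a' b' c' u' v' s' t' : 'I_4 -> R) :
  let G := pp_symbols a b c u v s t in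
  let dG m := pp_symbols (a' m) (b' m) (c' m) (u' m) (v' m) (s' m) (t' m) in
  a' ir = 0 -> b' ir = 0 -> c' ir = 0 -> s' ix = 0 -> t' ix = 0 ->
  s' ir = 0 -> t' ir = 0 -> s' i3 + t' i4 = 0 -> t' i3 = s' i4 ->
  forall k j,
    \sum_(i < 4) (dG i i j k - dG j i i k
      + \sum_(m < 4) (G i i m * G m j k - G i j m * G m i k)) =
    (u' i3 + v' i4 + 2 * (s * u + t * v)) * ((k == ix) && (j == ix))%:R.
Proof.
move=> G dG ar br cr sx tx sr tr /eqP; rewrite addrC addr_eq0 => /eqP st ts k j.
rewrite !big_ord4; elim/ord4_ind: k; elim/ord4_ind: j;
  rewrite /G /dG /pp_symbols /= ?(ar, br, cr, sx, tx, sr, tr, st, ts);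
  ring.
Qed.

End Arrays.

(** * Curvature and energy-momentum of a pp-wave *)

Section PPWave.
Variables (R : realType) (M : set 'rV[R]_4) (h f : 'rV[R]_4 -> R).
Hypothesis pw : pp_wave M h f.
Implicit Types (p q : 'rV[R]_4) (i j k l m : 'I_4).

Let g := pp_metric h f.
Let oM : open M := pp_open pw.
Let f_neq0 p : M p -> f p != 0 := @pp_f_neq0 _ _ _ _ pw p.

Let smooth_h := pp_h_smooth pw.
Let smooth_f := pp_f_smooth pw.

Let pd_derivable u i j p : smooth_on M u -> M p ->
  derivable (pd i u) p (delta_mx 0 j).
Proof. by move=> su; apply: smooth_on_derivable; exact: smooth_on_pd. Qed.

Lemma pp_metricE p i j :
  g p i j = pp_array (- 2 * h p) 1 0 (- 2^-1 * f p) i j.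
Proof.
by elim/ord4_ind: i; elim/ord4_ind: j; rewrite !mxE /pp_array /=; ring.
Qed.

Lemma pp_metric_tr p : (g p)^T = g p.
Proof.
apply/matrixP => i j; rewrite mxE !pp_metricE.
by elim/ord4_ind: i; elim/ord4_ind: j.
Qed.

Definition pp_metric_inv p : 'M[R]_4 :=
  \matrix_(i, j) pp_array 0 1 (2 * h p) (- 2 / f p) i j.

Lemma pp_metric_mul_inv p : M p -> g p *m pp_metric_inv p = 1%:M.
Proof.
move=> /f_neq0 f0; apply/matrixP => i j; rewrite !mxE big_ord4 !pp_metricE !mxE.
by elim/ord4_ind: i; elim/ord4_ind: j; rewrite /pp_array /=; field.
Qed.

Lemma pp_metric_unit p : M p -> g p \in unitmx.
Proof. by move=> /pp_metric_mul_inv/mulmx1_unit[]. Qed.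

Lemma invmx_pp_metric p : M p -> invmx (g p) = pp_metric_inv p.
Proof.
move=> Mp; rewrite -[RHS]mul1mx -(mulVmx (pp_metric_unit Mp)) -mulmxA.
by rewrite pp_metric_mul_inv // mulmx1.
Qed.

Lemma is_derive_pp_metric i j l p : M p ->
  is_derive p (delta_mx 0 l) (fun q => g q i j)
    (pp_array (- 2 * pd l h p) 0 0 (- 2^-1 * pd l f p) i j).
Proof.
move=> Mp; have -> : (fun q => g q i j) =
    (fun q => pp_array (- 2 * h q) 1 0 (- 2^-1 * f q) i j).
  by apply/funext => q; rewrite pp_metricE.
have dh := is_deriveZ (- 2)
  (derivableP (smooth_on_derivable (i := l) smooth_h Mp)).
have df := is_deriveZ (- 2^-1)
  (derivableP (smooth_on_derivable (i := l) smooth_f Mp)).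
rewrite /pp_array.
by case: (nat_of_ord i) => [|[|[|[|?]]]]; case: (nat_of_ord j) => [|[|[|[|?]]]];
  first [exact: is_derive_cst | exact: dh | exact: df].
Qed.

Let h_r p : M p -> pd ir h p = 0.
Proof. by apply: (pd_depends_only_on0 oM (pp_h_coord pw)); rewrite !inE. Qed.

Let f_x p : M p -> pd ix f p = 0.
Proof. by apply: (pd_depends_only_on0 oM (pp_f_coord pw)); rewrite !inE. Qed.

Let f_r p : M p -> pd ir f p = 0.
Proof. by apply: (pd_depends_only_on0 oM (pp_f_coord pw)); rewrite !inE. Qed.

Let h_ir i p : M p -> pd ir (pd i h) p = 0.
Proof.
move=> Mp.
apply: (pd_depends_only_on0 oM (depends_only_on_pd oM i
  (pp_h_coord pw))) Mp; by rewrite !inE.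
Qed.

Let f_ix i p : M p -> pd ix (pd i f) p = 0.
Proof.
move=> Mp.
apply: (pd_depends_only_on0 oM (depends_only_on_pd oM i
  (pp_f_coord pw))) Mp; by rewrite !inE.
Qed.

Let f_ir i p : M p -> pd ir (pd i f) p = 0.
Proof.
move=> Mp.
apply: (pd_depends_only_on0 oM (depends_only_on_pd oM i
  (pp_f_coord pw))) Mp; by rewrite !inE.
Qed.

Definition pp_christoffel k i j p :=
  pp_symbols (- pd ix h p) (- pd i3 h p) (- pd i4 h p)
    (- 2 * pd i3 h p / f p) (- 2 * pd i4 h p / f p)
    (2^-1 * pd i3 f p / f p) (2^-1 * pd i4 f p / f p) k i j.

Lemma christoffel_pp_metric k i j p : M p ->
  christoffel g k i j p = pp_christoffel k i j p.
Proof.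
move=> Mp; have f0 := f_neq0 Mp.
have dg l i' j' : pd l (fun q => g q i' j') p =
    pp_array (- 2 * pd l h p) 0 0 (- 2^-1 * pd l f p) i' j'.
  exact: (@derive_val _ _ _ _ _ _ _ (is_derive_pp_metric i' j' l Mp)).
rewrite /christoffel big_ord4 !dg invmx_pp_metric // !mxE /pp_christoffel.
elim/ord4_ind: k; elim/ord4_ind: i; elim/ord4_ind: j;
  rewrite /pp_array /pp_symbols /= ?(h_r Mp, f_x Mp, f_r Mp);
  move: (pd ix h p) (pd i3 h p) (pd i4 h p) (pd i3 f p) (pd i4 f p)
    (h p) (f p) f0 => hx h3 h4 f3 f4 h0 f1 f10; by field.
Qed.

Lemma pd_quotient u w (a : R) i p : M p -> smooth_on M u -> smooth_on M w ->
  w p != 0 -> pd i (fun q => a * u q / w q) p =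
    a * (pd i u p * w p - u p * pd i w p) / w p ^+ 2.
Proof.
move=> Mp su sw w0; exact: (@derive_val _ _ _ _ _ _ _ (is_derive_quotient
  a (smooth_on_derivable su Mp) (smooth_on_derivable sw Mp) w0)).
Qed.

Let pdN_h i m p : M p -> pd m (fun q => - pd i h q) p = - pd m (pd i h) p.
Proof. by move=> Mp; exact: (deriveN (pd_derivable smooth_h Mp)). Qed.

Let pd_h_over_f i m p : M p -> pd m (fun q => - 2 * pd i h q / f q) p =
  - 2 * (pd m (pd i h) p * f p - pd i h p * pd m f p) / f p ^+ 2.
Proof.
move=> Mp.
exact: (pd_quotient (- 2) m Mp (smooth_on_pd i smooth_h) smooth_f (f_neq0 Mp)).
Qed.

Let pd_f_over_f i m p : M p -> pd m (fun q => 2^-1 * pd i f q / f q) p =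
  2^-1 * (pd m (pd i f) p * f p - pd i f p * pd m f p) / f p ^+ 2.
Proof.
move=> Mp.
exact: (pd_quotient (2^-1) m Mp (smooth_on_pd i smooth_f) smooth_f (f_neq0 Mp)).
Qed.

Let derivable_f_over_f i m p : M p ->
  derivable (fun q => 2^-1 * pd i f q / f q) p (delta_mx 0 m).
Proof.
move=> Mp.
by case: (is_derive_quotient 2^-1 (pd_derivable (i := i) (j := m) smooth_f Mp)
  (smooth_on_derivable (i := m) smooth_f Mp) (f_neq0 Mp)).
Qed.

Lemma pd_christoffel_pp_metric k i j m p : M p ->
  pd m (christoffel g k i j) p =
  pp_symbols (- pd m (pd ix h) p) (- pd m (pd i3 h) p) (- pd m (pd i4 h) p)
    (pd m (fun q => - 2 * pd i3 h q / f q) p)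
    (pd m (fun q => - 2 * pd i4 h q / f q) p)
    (pd m (fun q => 2^-1 * pd i3 f q / f q) p)
    (pd m (fun q => 2^-1 * pd i4 f q / f q) p) k i j.
Proof.
move=> Mp.
rewrite (pd_eq_on oM (fun q Mq => christoffel_pp_metric k i j Mq)) //.
rewrite /pp_christoffel pd_pp_symbols; [|exact: derivable_f_over_f..].
by congr (pp_symbols _ _ _ _ _ _ _ k i j); exact: pdN_h.
Qed.

(** The function phi in the Ricci tensor phi dx^2. *)
Definition pp_ricci_coef p : R :=
  - 2 * (pd i3 (pd i3 h) p + pd i4 (pd i4 h) p) / f p.

Lemma ricci_pp_metric p : M p -> ricci g p = pp_ricci_coef p *: delta_mx ix ix.
Proof.
move=> Mp; have f0 := f_neq0 Mp; apply/matrixP => k j; rewrite !mxE.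
have zero (a b d : R) : a * (0 * b - d * 0) / b ^+ 2 = 0.
  by rewrite mul0r mulr0 subrr mulr0 mul0r.
under eq_bigr => i _.
  rewrite /riemann !pd_christoffel_pp_metric //.
  under eq_bigr => m _ do rewrite !christoffel_pp_metric //.
  over.
rewrite /pp_christoffel.
rewrite (@pp_symbols_ricci _ _ _ _ _ _ _ _
  (fun m => - pd m (pd ix h) p) (fun m => - pd m (pd i3 h) p)
  (fun m => - pd m (pd i4 h) p)
  (fun m => pd m (fun q => - 2 * pd i3 h q / f q) p)
  (fun m => pd m (fun q => - 2 * pd i4 h q / f q) p)
  (fun m => pd m (fun q => 2^-1 * pd i3 f q / f q) p)
  (fun m => pd m (fun q => 2^-1 * pd i4 f q / f q) p)).
- congr (_ * _); rewrite !pd_h_over_f // /pp_ricci_coef.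
  move: (pd i3 (pd i3 h) p) (pd i4 (pd i4 h) p) (pd i3 h p) (pd i4 h p)
    (pd i3 f p) (pd i4 f p) (f p) f0 => h33 h44 h3 h4 f3 f4 f1 f10.
  by field.
- by rewrite (h_ir ix Mp) oppr0.
- by rewrite (h_ir i3 Mp) oppr0.
- by rewrite (h_ir i4 Mp) oppr0.
- by rewrite (pd_f_over_f i3 ix Mp) (f_ix i3 Mp) (f_x Mp) zero.
- by rewrite (pd_f_over_f i4 ix Mp) (f_ix i4 Mp) (f_x Mp) zero.
- by rewrite (pd_f_over_f i3 ir Mp) (f_ir i3 Mp) (f_r Mp) zero.
- by rewrite (pd_f_over_f i4 ir Mp) (f_ir i4 Mp) (f_r Mp) zero.
- rewrite (pd_f_over_f i3 i3 Mp) (pd_f_over_f i4 i4 Mp).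
  (* [s_3 + t_4] is the left-hand side of the equation for [f], over 2 f^2. *)
  have := pp_f_eq pw Mp.
  move: (pd i3 (pd i3 f) p) (pd i4 (pd i4 f) p) (pd i3 f p) (pd i4 f p)
    (f p) f0.
  move=> f33 f44 f3 f4 f1 f10 e.
  by rewrite -[RHS](mulr0 (2^-1 / f1 ^+ 2)) -e; field.
- rewrite (pd_f_over_f i4 i3 Mp) (pd_f_over_f i3 i4 Mp).
  by rewrite (pdC oM i3 i4 smooth_f Mp) [pd i3 f p * _]mulrC.
Qed.

Let pp_Ricci q : 'M[R]_4 := pp_ricci_coef q *: delta_mx ix ix.

Lemma scalar_curvature_pp_metric p : M p -> scalar_curvature g p = 0.
Proof.
move=> Mp; rewrite /scalar_curvature !big_ord4 ricci_pp_metric //.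
by rewrite invmx_pp_metric // !mxE /pp_array /=; ring.
Qed.

Lemma energy_momentum_pp_metric c G Lam p : M p ->
  energy_momentum g c G Lam p =
  (c ^+ 4 / (8 * pi * G)) *: (pp_Ricci p + Lam *: g p).
Proof.
move=> Mp; rewrite /energy_momentum ricci_pp_metric //.
by rewrite scalar_curvature_pp_metric // mul0r sub0r scaleNr opprK.
Qed.

Lemma derivable_pp_ricci_coef i p : M p ->
  derivable pp_ricci_coef p (delta_mx 0 i).
Proof.
move=> Mp.
have dd j : derivable (pd j (pd j h)) p (delta_mx 0 i).
  exact: pd_derivable (smooth_on_pd j smooth_h) Mp.
by case: (is_derive_quotient (- 2) (derivableD (dd i3) (dd i4))
  (smooth_on_derivable (i := i) smooth_f Mp) (f_neq0 Mp)).
Qed.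

Lemma is_derive_pp_Ricci i j k p : M p ->
  is_derive p (delta_mx 0 i) (fun q => pp_Ricci q j k)
    (pd i pp_ricci_coef p * ((j == ix) && (k == ix))%:R).
Proof.
move=> Mp.
have -> : (fun q => pp_Ricci q j k) =
    ((j == ix) && (k == ix))%:R \*: pp_ricci_coef.
  by apply/funext => q; rewrite !mxE mulrC.
have d := is_deriveZ ((j == ix) && (k == ix))%:R
  (derivableP (derivable_pp_ricci_coef (i := i) Mp)).
by apply: is_derive_eq d _; rewrite mulrC.
Qed.

Lemma christoffel_ix i j p : M p -> christoffel g ix i j p = 0.
Proof. by move=> Mp; rewrite christoffel_pp_metric. Qed.

(** The coefficient [phi] is the only thing that gets differentiated: [dx] is
    parallel, since the symbols with upper index x vanish. *)
Lemma nabla_comp_pp_Ricci i j k p : M p -> nabla_comp g pp_Ricci i j k p =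
  pd i pp_ricci_coef p * ((j == ix) && (k == ix))%:R.
Proof.
move=> Mp; rewrite /nabla_comp.
have -> : pd i (fun q => pp_Ricci q j k) p =
    pd i pp_ricci_coef p * ((j == ix) && (k == ix))%:R.
  exact: (@derive_val _ _ _ _ _ _ _ (is_derive_pp_Ricci i j k Mp)).
rewrite !big1 ?subr0 // => l _; rewrite !mxE.
  have [->|_] := eqVneq l ix; first by rewrite (christoffel_ix i k Mp) mul0r.
  by rewrite andbF !mulr0.
have [->|_] := eqVneq l ix; first by rewrite (christoffel_ix i j Mp) mul0r.
by rewrite !mulr0.
Qed.

Lemma nabla_comp_energy_momentum c G Lam i j k p : M p ->
  nabla_comp g (energy_momentum g c G Lam) i j k p =
  c ^+ 4 / (8 * pi * G) *
    (pd i pp_ricci_coef p * ((j == ix) && (k == ix))%:R).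
Proof.
move=> Mp.
rewrite (nabla_comp_eq_on _ oM (@energy_momentum_pp_metric c G Lam)) //.
have [dS _] := is_derive_pp_Ricci i j k Mp.
have [dg _] := is_derive_pp_metric j k i Mp.
rewrite (nabla_comp_lin _ _ _ dS dg) nabla_comp_pp_Ricci //.
rewrite (nabla_comp_metric _ _ _ pp_metric_tr (pp_metric_unit Mp)).
by rewrite mulr0 addr0.
Qed.

End PPWave.

(** * Conditions on the covariant derivative, in components *)

Section Components.
Variables (R : realType) (M : set 'rV[R]_4) (g T : 'rV[R]_4 -> 'M[R]_4).
Implicit Types (p : 'rV[R]_4) (i j k : 'I_4).

Let coord_field i : 'rV[R]_4 -> 'rV[R]_4 := fun=> delta_mx 0 i.

Let smooth_coord_field i : smooth_vf_on M (coord_field i).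
Proof. by move=> j; exact: smooth_on_cst. Qed.

Lemma nabla_coord_field i j k p :
  nabla g T (coord_field i) (coord_field j) (coord_field k) p =
  nabla_comp g T i j k p.
Proof.
rewrite /nabla (bigD1 i) //= (bigD1 j) //= (bigD1 k) //= !mxE !eqxx !mul1r.
rewrite !big1 ?addr0 // => [a ai|a aj|a ak].
- rewrite big1 // => b _; rewrite big1 // => d _.
  by rewrite !mxE (negPf ai) !mul0r.
- by rewrite big1 // => b _; rewrite !mxE (negPf aj) mulr0 !mul0r.
- by rewrite !mxE (negPf ak) mulr0 mul0r.
Qed.

Lemma parallel_comp :
  parallel g M T <-> (forall p i j k, M p -> nabla_comp g T i j k p = 0).
Proof.
split=> [par p i j k Mp | N0 X Y Z _ _ _ p Mp].
  by rewrite -nabla_coord_field; apply: par.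
rewrite /nabla big1 // => i _; rewrite big1 // => j _; rewrite big1 // => k _.
by rewrite N0 ?mulr0.
Qed.

Lemma codazzi_comp : codazzi g M T <->
  (forall p i j k, M p -> nabla_comp g T i j k p = nabla_comp g T j i k p).
Proof.
split=> [cod p i j k Mp | NC X Y Z _ _ _ p Mp].
  by rewrite -!nabla_coord_field; apply: cod.
rewrite /nabla [RHS]exchange_big; apply: eq_bigr => i _.
apply: eq_bigr => j _; apply: eq_bigr => k _.
by rewrite NC // (mulrC (Y p 0 j)).
Qed.

Lemma cyclic_parallel_comp : cyclic_parallel g M T ->
  forall p i j k, M p -> nabla_comp g T i j k p + nabla_comp g T j k i p
    + nabla_comp g T k i j p = 0.
Proof. by move=> cyc p i j k Mp; rewrite -!nabla_coord_field; apply: cyc. Qed.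

Lemma parallel_cyclic : parallel g M T -> cyclic_parallel g M T.
Proof. by move=> par X Y Z sX sY sZ p Mp; rewrite !par ?addr0. Qed.

End Components.

(** * The conditions on T as conditions on d phi *)

Section EnergyMomentum.
Variables (R : realType) (c G Lam : R).
Hypotheses (c_gt0 : 0 < c) (G_gt0 : 0 < G).
Variables (M : set 'rV[R]_4) (h f : 'rV[R]_4 -> R).
Hypothesis pw : pp_wave M h f.

Let g := pp_metric h f.
Let T := energy_momentum g c G Lam.
Let phi := pp_ricci_coef h f.

Let einstein_neq0 : c ^+ 4 / (8 * pi * G) != 0.
Proof. by rewrite gt_eqF // divr_gt0 ?exprn_gt0 // !mulr_gt0 ?pi_gt0. Qed.

Let nablaT i j k p (Mp : M p) : nabla_comp g T i j k p =
    c ^+ 4 / (8 * pi * G) * (pd i phi p * ((j == ix) && (k == ix))%:R) :=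
  nabla_comp_energy_momentum pw c G Lam i j k Mp.

Lemma parallel_energy_momentum :
  parallel g M T <-> (forall p i, M p -> pd i phi p = 0).
Proof.
rewrite parallel_comp; split=> [N0 p i Mp | d0 p i j k Mp].
  have /eqP := N0 p i ix ix Mp.
  rewrite (nablaT _ _ _ Mp) mulr1 mulf_eq0.
  by rewrite (negPf einstein_neq0) => /eqP.
by rewrite (nablaT _ _ _ Mp) d0 // mul0r mulr0.
Qed.

(** The component (i, x, x) of the cyclic sum is [K d_i phi] when [i] is not x,
    and [3 K d_x phi] when it is. *)
Lemma cyclic_parallel_energy_momentum : cyclic_parallel g M T ->
  forall p i, M p -> pd i phi p = 0.
Proof.
move=> /cyclic_parallel_comp N0 p i Mp; have /eqP := N0 p i ix ix Mp.
rewrite !(nablaT _ _ _ Mp) -!mulrDr mulf_eq0.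
rewrite (negPf einstein_neq0) /= mulr1 -/phi.
have [->|_] := eqVneq i ix; last by rewrite !mulr0 !addr0 => /eqP.
by rewrite !mulr1 -mulr2n -mulrSr mulrn_eq0 => /eqP.
Qed.

Lemma codazzi_energy_momentum :
  codazzi g M T <-> (forall p i, i != ix -> M p -> pd i phi p = 0).
Proof.
rewrite codazzi_comp; split=> [NC p i iNx Mp | d0 p i j k Mp].
  have /eqP := NC p i ix ix Mp.
  rewrite !(nablaT _ _ _ Mp) (inj_eq (mulfI einstein_neq0)).
  by rewrite mulr1 (negPf iNx) mulr0 => /eqP.
rewrite !(nablaT _ _ _ Mp) -/phi; congr (_ * _).
have [->|iNx] := eqVneq i ix; have [->|jNx] := eqVneq j ix.
- by [].
- by rewrite (d0 p j jNx Mp) mul0r mulr0n mulr0.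
- by rewrite (d0 p i iNx Mp) mul0r mulr0n mulr0.
- by rewrite !mulr0n !mulr0.
Qed.

End EnergyMomentum.

(** * A pp-wave that separates Codazzi from cyclic parallel *)

(** The space is the union of its lines through the origin. *)
Lemma connected_normed_module (R : realType) (V : normedModType R) :
  connected [set: V].
Proof.
have -> : [set: V] = \bigcup_(v in [set: V]) ((fun t : R => t *: v) @` setT).
  by apply/seteqP; split=> // v _; exists v => //; exists 1; rewrite ?scale1r.
apply: bigcup_connected => [|v _].
  by exists 0 => v _; exists 0; rewrite ?scale0r.
apply: connected_continuous_connected.
  exact/connected_intervalP.
by apply: continuous_subspaceT; exact: scalel_continuous.
Qed.

Section PolynomialWaves.
Variable R : realType.
Implicit Types (P Q : {poly R}) (p q : 'rV[R]_4) (i k : 'I_4).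

(** This family of functions is stable under all partial derivatives, which
    makes its smoothness a one-line induction. *)
Definition poly_field P Q : 'rV[R]_4 -> R := fun q => P.[q 0 ix] * Q.[q 0 i3].

Lemma is_derive_horner_coord P k i p :
  is_derive p (delta_mx 0 i) (fun q => P.[q 0 k])
    (P^`().[p 0 k] * (i == k)%:R).
Proof.
have [->|iNk] := eqVneq i k.
  have inc : \forall t \near (0 : R),
      P.[t *: 1 + p 0 k] - P.[p 0 k] =
      P.[(t *: delta_mx 0 k + p) 0 k] - P.[p 0 k].
    by near=> t; rewrite !mxE !eqxx.
  have [dP eP] := is_derive_poly P (p 0 k).
  split; first exact: (derivable_eq_increments inc dP).
  by rewrite mulr1 -eP; exact: esym (derive_eq_increments inc).
have inc : \forall t \near (0 : R), (0 : R) - 0 =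
    P.[(t *: delta_mx 0 i + p) 0 k] - P.[p 0 k].
  near=> t; rewrite subrr !mxE eqxx (eq_sym k) (negPf iNk).
  by rewrite mulr0n mulr0 add0r subrr.
have [d0 e0] := is_derive_cst (0 : R) p (delta_mx 0 i).
split; first exact: (derivable_eq_increments inc d0).
by rewrite mulr0 -e0; exact: esym (derive_eq_increments inc).
Unshelve. all: by end_near. Qed.

Definition poly_field_deriv i P Q :=
  if i == ix then (P^`(), Q) else if i == i3 then (P, Q^`()) else (0, Q).

Lemma is_derive_poly_field P Q i p :
  is_derive p (delta_mx 0 i) (poly_field P Q)
    (let PQ := poly_field_deriv i P Q in poly_field PQ.1 PQ.2 p).
Proof.
have d := is_deriveM (is_derive_horner_coord P ix i p)
  (is_derive_horner_coord Q i3 i p).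
apply: is_derive_eq d _; rewrite /poly_field_deriv /poly_field /GRing.scale /=.
by elim/ord4_ind: i => /=; rewrite ?horner0; ring.
Qed.

Lemma pd_poly_field P Q i : pd i (poly_field P Q) =
  let PQ := poly_field_deriv i P Q in poly_field PQ.1 PQ.2.
Proof.
apply/funext => p.
exact: (@derive_val _ _ _ _ _ _ _ (is_derive_poly_field P Q i p)).
Qed.

Lemma continuous_poly_field P Q : continuous (poly_field P Q).
Proof.
move=> p.
have c (S : {poly R}) k :
    (fun q : 'rV[R]_4 => S.[q 0 k]) @ p --> S.[p 0 k].
  apply: (@continuous_comp _ _ _ (fun q : 'rV[R]_4 => q 0 k) (horner S)).
    exact: coord_continuous.
  exact: continuous_horner.
exact: cvgM (c P ix) (c Q i3).
Qed.

Lemma smooth_on_poly_field (M : set 'rV[R]_4) P Q :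
  smooth_on M (poly_field P Q).
Proof.
move=> s p _; have [P' [Q' ->]] : exists P' Q', iter_pd s (poly_field P Q) =
    poly_field P' Q'.
  elim: s => [|i s [P' [Q' IHs]]]; first by exists P, Q.
  by rewrite /= IHs pd_poly_field; do 2!eexists.
split=> [|i]; first exact: continuous_poly_field.
by case: (is_derive_poly_field P' Q' i p).
Qed.

End PolynomialWaves.

Section Counterexample.
Variable R : realType.

Let P : {poly R} := 'X^2 + 1.
Let h : 'rV[R]_4 -> R := poly_field (- 2^-1 *: P) P.

Let P_gt0 x : 0 < P.[x].
Proof. by rewrite !hornerE ltr_wpDl ?sqr_ge0. Qed.

Lemma poly_pp_wave : pp_wave setT h (fun=> - 2).
Proof.
have -> : h = fun q => - 2^-1 * poly_field P P q.
  by apply/funext => q; rewrite /h /poly_field hornerZ mulrA.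
apply: pp_wave_brinkmann.
- exact: openT.
- exact: connected_normed_module.
- exact: smooth_on_poly_field.
- move=> p q _ _ pq; rewrite /poly_field.
  by rewrite (pq ix) ?(pq i3) // !inE.
- by move=> p _; rewrite gt_eqF // mulr_gt0.
Qed.

Lemma pp_ricci_coef_poly_field :
  pp_ricci_coef h (fun=> - 2) = poly_field (- 2^-1 *: P) P^`()^`().
Proof.
apply/funext => q; rewrite /pp_ricci_coef !pd_poly_field /=.
rewrite /poly_field horner0 mul0r addr0.
by rewrite mulrAC divff ?mul1r // oppr_eq0 pnatr_eq0.
Qed.

Let derivP : P^`() = 'X *+ 2.
Proof. by rewrite derivD derivXn -[1]/(1%:P) derivC addr0. Qed.

Lemma pd_pp_ricci_coef_poly_field i p :
  pd i (pp_ricci_coef h (fun=> - 2)) p = - 2 * p 0 ix * (i == ix)%:R.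
Proof.
rewrite pp_ricci_coef_poly_field pd_poly_field derivP derivMn derivX.
elim/ord4_ind: i; rewrite /poly_field_deriv /= /poly_field ?derivZ ?derivP
  ?derivMn -?[1]/(1%:P) ?derivC !hornerE ?mul0rn ?hornerE //=.
by field.
Qed.

End Counterexample.

Theorem theorem5p2 (R : realType) (c G Lam : R) (hc : 0 < c) (hG : 0 < G) :
  (* (i) *)
  (forall (M : set 'rV[R]_4) (h f : 'rV[R]_4 -> R), pp_wave M h f ->
     let g := pp_metric h f in
     let T := energy_momentum g c G Lam in
     parallel g M T <-> cyclic_parallel g M T)
  /\
  (* (ii) *)
  ((forall (M : set 'rV[R]_4) (h f : 'rV[R]_4 -> R), pp_wave M h f ->
      let g := pp_metric h f in
      let T := energy_momentum g c G Lam in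
      cyclic_parallel g M T -> codazzi g M T)
   /\
   (exists (M : set 'rV[R]_4) (h f : 'rV[R]_4 -> R), pp_wave M h f /\
      let g := pp_metric h f in
      let T := energy_momentum g c G Lam in
      codazzi g M T /\ ~ cyclic_parallel g M T))
  /\
  (* (iii) *)
  (forall (M : set 'rV[R]_4) (h f : 'rV[R]_4 -> R), pp_wave M h f ->
     let g := pp_metric h f in
     let T := energy_momentum g c G Lam in
     (forall p, M p -> pd i3 (pd i3 h) p + pd i4 (pd i4 h) p = 0) ->
     (forall p, M p -> ricci g p = 0) /\ parallel g M T).
Proof.
have par_iff M h f (pw : pp_wave M h f) :
    let g := pp_metric h f in let T := energy_momentum g c G Lam in
    parallel g M T <-> cyclic_parallel g M T.
  split; first exact: parallel_cyclic.
  move=> /(cyclic_parallel_energy_momentum hc hG pw) d0.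
  exact/(parallel_energy_momentum Lam hc hG pw).
split; [exact: par_iff | split; [split|]].
- move=> M h f pw g T /(par_iff _ _ _ pw) par X Y Z sX sY sZ p Mp.
  by rewrite !par.
- exists setT, (poly_field (- 2^-1 *: ('X^2 + 1)) ('X^2 + 1)), (fun=> - 2).
  have pw := poly_pp_wave R; split; first exact: pw.
  split.
    apply/(codazzi_energy_momentum Lam hc hG pw) => p i iNx _.
    by rewrite pd_pp_ricci_coef_poly_field (negPf iNx) mulr0n mulr0.
  (* [d_x phi = - 2 x] does not vanish at a point with [x = 1]. *)
  move=> /(cyclic_parallel_energy_momentum hc hG pw).
  move=> /(_ (const_mx 1) ix I) /eqP.
  rewrite pd_pp_ricci_coef_poly_field mxE eqxx !mulr1.
  by rewrite oppr_eq0 pnatr_eq0.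
- move=> M h f pw g T harm.
  have phi0 p : M p -> pp_ricci_coef h f p = 0.
    by move=> Mp; rewrite /pp_ricci_coef harm // mulr0 mul0r.
  split=> [p Mp|].
    by rewrite (ricci_pp_metric pw Mp) phi0 // scale0r.
  apply/(parallel_energy_momentum Lam hc hG pw) => p i Mp.
  rewrite (pd_eq_on (pp_open pw) phi0 i Mp); exact: derive_cst.
Qed.
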